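(* Let $d\geq 2$, $0<s<1$, $p>1$, $q\geq 1$, $\tau\geq 1$, $0<a\leq 1$, $\alpha,\beta,\gamma\in\mathbb{R}$, and $\Lambda>1$. Define $\sigma\in\mathbb{R}$ by $\gamma=a\sigma+(1-a)\beta$, and assume $$\frac{1}{\tau}+\frac{\gamma}{d}=a\left(\frac{1}{p}+\frac{\alpha-s}{d}\right)+(1-a)\left(\frac{1}{q}+\frac{\beta}{d}\right).$$ Suppose that one of the following two assertions holds: (i) $\frac{1}{\tau}+\frac{\gamma}{d}>0$ and there is a constant $C>0$ such that $$\left\||x|^\gamma u\right\|_{L^\tau(\mathbb{R}^d)}\leq C\,\|u\|^a_{\dot W^{s,p,\alpha,\Lambda}(\mathbb{R}^d)}\left\||x|^\beta u\right\|^{1-a}_{L^q(\mathbb{R}^d)}$$ for all radial $u\in L^1_{loc}(\mathbb{R}^d\setminus\{0\})$ with compact support in $\mathbb{R}^d$; (ii) $\frac{1}{\tau}+\frac{\gamma}{d}<0$ and there is a constant $C>0$ such that the same inequality holds for all radial $u\in L^1_{loc}(\mathbb{R}^d\setminus\{0\})$ which is $0$ in a neighborhood of $0$. Then $\alpha-\sigma\geq-(d-1)s$.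
   Context: For $p>1$, $0<s<1$, $\alpha\in\mathbb{R}$, $\Lambda>1$, an open set $\Omega\subset\mathbb{R}^d$ and a measurable function $g$ on $\Omega$, $$\|g\|^p_{\dot W^{s,p,\alpha,\Lambda}(\Omega)}=\int_\Omega\int_\Omega\frac{|g(x)-g(y)|^p|x|^{\alpha p}}{|x-y|^{d+sp}}\chi_\Lambda(|x|,|y|)\,dx\,dy,$$ where, for $r_1,r_2\geq 0$, $\chi_\Lambda(r_1,r_2)=1$ if $\Lambda^{-1}r_1\leq r_2\leq\Lambda r_1$ and $\chi_\Lambda(r_1,r_2)=0$ otherwise. The quantities in the inequality may be infinite; the conventions are $+\infty\cdot 0=0\cdot(+\infty)=0$, $(+\infty)^0=1$ (this corresponds to the case $a=1$), and $+\infty\leq+\infty$. *)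

(* Defs.v *)
From HB Require Import structures.
From mathcomp Require Import all_boot all_order all_algebra.
From mathcomp Require Import all_classical all_reals all_analysis.

Set Implicit Arguments.
Unset Strict Implicit.
Unset Printing Implicit Defensive.

Import Order.TTheory GRing.Theory Num.Theory.
Import numFieldNormedType.Exports.

Local Open Scope classical_set_scope.
Local Open Scope ring_scope.

(* The row vectors 'rV[R]_n carry the sigma-algebra generated by the
   coordinates (the same convention as for n.-tuple R in
   measurable_structure.v); since R is second countable, it is the Borel
   sigma-algebra of the topology of 'rV[R]_n. *)
Definition measure_rV_display : measure_display.
Proof. exact: default_measure_display. Qed.

Section measurable_rV.
Context {R : realType} (n : nat).

Definition coord_rV (i : 'I_n) (x : 'rV[R]_n) : measurableTypeR R := x ord0 i.

Let rV_set0 : g_sigma_preimage coord_rV set0.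
Proof. exact: sigma_algebra0. Qed.

Let rV_setC A : g_sigma_preimage coord_rV A -> g_sigma_preimage coord_rV (~` A).
Proof. exact: sigma_algebraC. Qed.

Let rV_bigcup (F : _^nat) : (forall i, g_sigma_preimage coord_rV (F i)) ->
  g_sigma_preimage coord_rV (\bigcup_i (F i)).
Proof. exact: sigma_algebra_bigcup. Qed.

HB.instance Definition _ := @isMeasurable.Build measure_rV_display
  'rV[R]_n (g_sigma_preimage coord_rV) rV_set0 rV_setC rV_bigcup.

End measurable_rV.

Lemma measurable_coord_rV {R : realType} n (i : 'I_n) :
  measurable_fun [set: 'rV[R]_n] (coord_rV i).
Proof.
move=> _ Y mY; rewrite setTI; apply: sub_sigma_algebra => /=.
rewrite -bigcup_seq/=; exists i => /=; first by rewrite mem_index_enum.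
by exists Y => //; rewrite setTI.
Qed.

Lemma measurable_fun_rV {R : realType} d (T : measurableType d) n
    (f : T -> 'rV[R]_n) :
  (forall i, measurable_fun [set: T] (coord_rV i \o f)) ->
  measurable_fun [set: T] f.
Proof.
move=> mf _ A mA; rewrite setTI.
suff : @measurable _ 'rV[R]_n `<=` [set B | measurable (f @^-1` B)] by exact.
apply: smallest_sub => /=.
  split.
  - by rewrite /= preimage_set0; exact: measurable0.
  - by move=> B /= mB; rewrite setTD preimage_setC; exact: measurableC.
  - by move=> F /= mF; rewrite preimage_bigcup; exact: bigcup_measurable.
move=> B; rewrite -bigcup_seq/= => -[i _ [Y mY <-]] /=.
by rewrite setTI -[X in measurable X]setTI; exact: mf.
Qed.

Section cons_rV.
Context {R : realType} (n : nat).

Definition cons_rV (p : measurableTypeR R * 'rV[R]_n) : 'rV[R]_n.+1 :=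
  \row_i oapp (p.2 ord0) p.1 (unlift ord0 i).

Definition uncons_rV (x : 'rV[R]_n.+1) : measurableTypeR R * 'rV[R]_n :=
  (x ord0 ord0, \row_i x ord0 (lift ord0 i)).

Lemma cons_rVK : cancel cons_rV uncons_rV.
Proof.
move=> [x v]; rewrite /uncons_rV mxE unlift_none/=; congr pair.
by apply/rowP => i; rewrite !mxE liftK.
Qed.

Lemma measurable_cons_rV : measurable_fun setT cons_rV.
Proof.
apply: measurable_fun_rV => i; case: (unliftP ord0 i) => [j ->|->].
  rewrite (_ : _ \o _ = coord_rV j \o snd); last first.
    by apply/funext => p /=; rewrite /coord_rV mxE liftK.
  exact: measurableT_comp (measurable_coord_rV j) measurable_snd.
rewrite (_ : _ \o _ = fst); first exact: measurable_fst.
by apply/funext => p /=; rewrite /coord_rV mxE unlift_none.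
Qed.

Lemma measurable_uncons_rV : measurable_fun setT uncons_rV.
Proof.
apply: measurable_fun_pair; first exact: (measurable_coord_rV ord0).
apply: measurable_fun_rV => i.
rewrite (_ : _ \o _ = coord_rV (lift ord0 i)); first exact: measurable_coord_rV.
by apply/funext => x /=; rewrite /coord_rV mxE.
Qed.

End cons_rV.

Section lebesgue_step.
Local Open Scope ereal_scope.
Context {R : realType} (n : nat).
Variable m : {sigma_finite_measure set 'rV[R]_n -> \bar R}.

Definition lebesgue_step : set 'rV[R]_n.+1 -> \bar R :=
  pushforward (@lebesgue_measure R \x m) (@cons_rV R n).

Let mpush : {measure set 'rV[R]_n.+1 -> \bar R}.
Proof.
refine (pushforward (@lebesgue_measure R \x m) (@cons_rV R n)).
exact: measurable_cons_rV.
Defined.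

Let lebesgue_step0 : lebesgue_step set0 = 0.
Proof. exact: (measure0 mpush). Qed.

Let lebesgue_step_ge0 A : 0 <= lebesgue_step A.
Proof. exact: (measure_ge0 mpush). Qed.

Let lebesgue_step_sigma_additive : semi_sigma_additive lebesgue_step.
Proof. exact: (@measure_semi_sigma_additive _ _ _ mpush). Qed.

HB.instance Definition _ := isMeasure.Build _ _ _ lebesgue_step
  lebesgue_step0 lebesgue_step_ge0 lebesgue_step_sigma_additive.

Let lebesgue_step_sigma_finite : sigma_finite setT lebesgue_step.
Proof.
have /sigma_finiteP[F [TF ndF Foo]] := sigma_finiteT (@lebesgue_measure R).
have /sigma_finiteP[G [TG ndG Goo]] := sigma_finiteT m.
exists (fun k => @uncons_rV R n @^-1` (F k `*` G k)).
  apply/seteqP; split => // x _.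
  have [i _ Fi] : (\bigcup_i F i) (uncons_rV x).1 by rewrite -TF.
  have [j _ Gj] : (\bigcup_j G j) (uncons_rV x).2 by rewrite -TG.
  exists (maxn i j) => //; split.
    by move: Fi; exact/subsetPset/ndF/leq_maxl.
  by move: Gj; exact/subsetPset/ndG/leq_maxr.
move=> k; have [mF Fk] := Foo k; have [mG Gk] := Goo k; split.
  rewrite -[X in measurable X]setTI; apply: measurable_uncons_rV => //.
  exact: measurableX.
rewrite /lebesgue_step /pushforward -comp_preimage.
rewrite (_ : _ \o _ = id); last by apply/funext => p /=; rewrite cons_rVK.
by rewrite preimage_id product_measure1E// lte_mul_pinfty// ge0_fin_numE.
Qed.

HB.instance Definition _ := @Measure_isSigmaFinite.Build _ _ _ lebesgue_step
  lebesgue_step_sigma_finite.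

End lebesgue_step.

(* The Lebesgue measure on R^n, as the n-fold product of the Lebesgue measure
   on R; lebesgue_rV_box below characterizes it. *)
Fixpoint lebesgue_rV (R : realType) (n : nat) :
    {sigma_finite_measure set 'rV[R]_n -> \bar R} :=
  match n with
  | 0 => dirac (0 : 'rV[R]_0)
  | k.+1 => lebesgue_step (lebesgue_rV R k)
  end.

Lemma lebesgue_rV_box (R : realType) n (A : 'I_n -> set (measurableTypeR R)) :
  (forall i, measurable (A i)) ->
  lebesgue_rV R n [set x : 'rV[R]_n | forall i, A i (x ord0 i)] =
  (\prod_(i < n) lebesgue_measure (A i))%E.
Proof.
elim: n A => [|n IH] A mA.
  by rewrite big_ord0 /= diracE mem_set// => -[].
rewrite big_ord_recl /= /lebesgue_step /pushforward.
set B := [set x : 'rV[R]_n | forall i, A (lift ord0 i) (x ord0 i)].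
have mB : measurable B.
  rewrite (_ : B =
      \bigcap_(i in [set: 'I_n]) (coord_rV i @^-1` A (lift ord0 i))).
    apply: fin_bigcap_measurable => // i _.
    by rewrite -[X in measurable X]setTI; exact: measurable_coord_rV.
  by apply/seteqP; split=> [x Bx i _|x Bx i]; [exact: Bx|exact: (Bx i I)].
rewrite -(IH (fun i => A (lift ord0 i)))// -product_measure1E//.
congr (_ _); apply/seteqP; split=> -[x v] /=.
  move=> H; split => [|i]; first by have := H ord0; rewrite mxE unlift_none.
  by have := H (lift ord0 i); rewrite mxE liftK.
by move=> [Ax Bv] i; rewrite mxE; case: (unliftP ord0 i) => [j ->|->] //=.
Qed.

Section function_spaces.
Context {R : realType} (d : nat).
Implicit Types (u : 'rV[R]_d -> R) (Om : set 'rV[R]_d).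

Definition enorm (x : 'rV[R]_d) : R := Num.sqrt (\sum_(i < d) x ord0 i ^+ 2).

Definition radial u := forall x y, enorm x = enorm y -> u x = u y.

(* lebesgue_integral_differentiation.locally_integrable, which is only stated
   on R, with R replaced by R^d *)
Definition locally_integrable_rV Om u :=
  [/\ measurable_fun Om u, open Om &
    forall K, K `<=` Om -> compact K ->
      (\int[lebesgue_rV R d]_(x in K) `|u x|%:E < +oo)%E].

Definition compactly_supported u :=
  compact (closure [set x : 'rV[R]_d | u x != 0]).

Definition chi (Lambda r1 r2 : R) : R :=
  ((Lambda^-1 * r1 <= r2) && (r2 <= Lambda * r1))%:R.

(* The points where the integrand is affected by the conventions 0^-1 = 0 and
   0 `^ r = 0 for r != 0, i.e., x = y and x = 0, form a null set. *)
Definition sobolev_integrand (s p alpha Lambda : R) u (x y : 'rV[R]_d) : R :=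
  `|u x - u y| `^ p * enorm x `^ (alpha * p)
    / enorm (x - y) `^ (d%:R + s * p) * chi Lambda (enorm x) (enorm y).

Definition sobolev_seminorm (s p alpha Lambda : R) Om u : \bar R :=
  ((\int[lebesgue_rV R d]_(y in Om) \int[lebesgue_rV R d]_(x in Om)
     (sobolev_integrand s p alpha Lambda u x y)%:E) `^ p^-1)%E.

Definition weighted_norm (gamma tau : R) u : \bar R :=
  Lnorm (lebesgue_rV R d) tau%:E (fun x => (enorm x `^ gamma * u x)%:E).

(* poweR and mule satisfy (+oo) `^ 0 = 1 and +oo * 0 = 0 * +oo = 0. *)
Definition interpolation_ineq
    (s p q tau a alpha beta gamma Lambda C : R) u : Prop :=
  (weighted_norm gamma tau u <=
   C%:E * (sobolev_seminorm s p alpha Lambda setT u `^ a *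
           weighted_norm beta q u `^ (1 - a)%R))%E.

End function_spaces.

(* Main.v *)
(** Test the inequality on the tent [u_e(x) = max(0, 1 - ||x| - 1| / e)], which
lives on a shell of thickness of order [e] around the unit sphere, and let [e]
go to 0.  The shell has measure of order [e] and the weights are bounded above
and below on it, so the weighted [L^tau] and [L^q] norms are of order
[e^(1/tau)] and [e^(1/q)].  The seminorm is at most of order [e^(1/p - s)]:
one of [x], [y] lies in the shell, the cut-off [chi] then keeps [|x|] away from
0 and infinity, and integrating [min(1, |h|/e)^p |h|^(-d-sp)] over dyadic
shells in [h] gives [e^(-sp)].  Hence
[a (1/p - s) + (1 - a) / q <= 1 / tau], which is the claim after eliminating
[tau], [beta] and [gamma] with the scaling relation. *)
Require Import Defs.
From mathcomp Require Import all_boot all_order all_algebra.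
From mathcomp Require Import all_classical all_reals all_analysis.
From mathcomp Require Import ring lra measurable_realfun.

Set Implicit Arguments.
Unset Strict Implicit.
Unset Printing Implicit Defensive.

Import Order.TTheory GRing.Theory Num.Theory.
Import numFieldNormedType.Exports.

Local Open Scope classical_set_scope.
Local Open Scope ring_scope.

(** * Boxes and the scaling of Lebesgue measure *)

Definition rV_box {R : realType} {n : nat}
    (A : 'I_n -> set (measurableTypeR R)) : set 'rV[R]_n :=
  [set x | forall i, A i (x ord0 i)].

Lemma measurable_rV_box {R : realType} {n : nat}
    (A : 'I_n -> set (measurableTypeR R)) :
  (forall i, measurable (A i)) -> measurable (rV_box A).
Proof.
move=> mA; rewrite (_ : rV_box A =
    \bigcap_(i in [set: 'I_n]) (coord_rV i @^-1` A i)).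
  apply: fin_bigcap_measurable => // i _.
  by rewrite -[X in measurable X]setTI; exact: measurable_coord_rV.
by apply/seteqP; split=> [x Ax i _|x Ax i]; [exact: Ax|exact: (Ax i I)].
Qed.

(** Uniqueness theorems for measures need a bundled measure; the existential supplies one and
    exposes only its values on sets. *)
Lemma pushforward_scale_exists {d d' : measure_display}
    {T : measurableType d} {T' : measurableType d'} {R : realType} (c : R)
    (mu : {measure set T -> \bar R}) (f : T -> T') :
  0 <= c -> measurable_fun setT f ->
  exists m : {measure set T' -> \bar R},
    forall A, m A = (c%:E * mu (f @^-1` A))%E.
Proof.
move=> c0 mf.
have [m mE] : exists m : {measure set T' -> \bar R},
    forall A, m A = mu (f @^-1` A).
  unshelve eexists; first by refine (pushforward mu f); exact: mf.
  by [].
exists [the measure _ _ of mscale (NngNum c0) m] => A.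
by rewrite /= /mscale/= mE.
Qed.

Lemma measurable_scaleR {R : realType} (c : R) :
  measurable_fun [set: measurableTypeR R]
    (fun x : measurableTypeR R => c * x : measurableTypeR R).
Proof. by apply: measurable_funM => //; exact: measurable_id. Qed.

(** Both sides are measures of [A] that agree on half-open intervals, and these determine Lebesgue
    measure. *)
Lemma lebesgue_measure_scale {R : realType} (c : R)
    (A : set (measurableTypeR R)) : 0 < c -> measurable A ->
  (c%:E * lebesgue_measure
     ((fun x : measurableTypeR R => (c * x)%R : measurableTypeR R) @^-1` A) =
   lebesgue_measure A)%E.
Proof.
move=> c0 mA.
have [m mE] := pushforward_scale_exists (@lebesgue_measure R) (ltW c0)
  (measurable_scaleR c).
rewrite -mE; apply/esym/lebesgue_measure_unique => // _ [[a b] _ <-] /=.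
rewrite mE (_ : _ @^-1` _ = `]c^-1 * a, c^-1 * b]%classic); last first.
  by apply/seteqP; split=> x /=; rewrite !in_itv/= ltr_pdivrMl// ler_pdivlMl.
rewrite !lebesgue_measure_itv/= !lte_fin.
have /= -> := lebesgue_measure_itv `](c^-1 * a), (c^-1 * b)].
rewrite lte_fin ltr_pM2l ?invr_gt0//; case: ifPn => _; last by rewrite mule0.
by rewrite -!EFinB -EFinM -mulrBr mulrA divff ?mul1r// gt_eqF.
Qed.

Lemma measurable_scale_rV {R : realType} n (c : R) :
  measurable_fun [set: 'rV[R]_n] (fun x : 'rV[R]_n => c *: x).
Proof.
apply: measurable_fun_rV => i.
rewrite (_ : _ \o _ = (fun x => c * (coord_rV i x : R))); last first.
  by apply/funext => x /=; rewrite /coord_rV mxE.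
by apply: measurable_funM => //; exact: measurable_coord_rV.
Qed.

(** Boxes generate the sigma-algebra and are stable under intersection, so it suffices to compare
    the two measures on boxes. There the identity splits into [n] one-dimensional scalings, each
    contributing one factor [c]. *)
Lemma lebesgue_rV_scale {R : realType} n (c : R) (A : set 'rV[R]_n) :
  0 < c -> measurable A ->
  ((c ^+ n)%:E * lebesgue_rV R n ((fun x : 'rV[R]_n => (c *: x)%R) @^-1` A) =
   lebesgue_rV R n A)%E.
Proof.
move=> c0 mA.
have c0n : 0 <= c ^+ n by rewrite exprn_ge0// ltW.
have [m mE] := pushforward_scale_exists (lebesgue_rV R n) c0n
  (@measurable_scale_rV R n c).
rewrite -mE.
pose G : set (set 'rV[R]_n) :=
  [set B | exists2 A, (forall i, measurable (A i)) & B = rV_box A].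
(* Boxes of finite measure exhausting the space, as the uniqueness theorem requires. *)
pose g k : set 'rV[R]_n := rV_box (fun=> `[- k%:R, k%:R]%classic).
have gfin k : (lebesgue_rV R n (g k) < +oo)%E.
  rewrite lebesgue_rV_box//.
  have H : (lebesgue_measure `[- k%:R, k%:R]%classic :
    \bar R) = (k%:R + k%:R)%:E.
    rewrite lebesgue_measure_itv/= lte_fin; case: ltP => [_|kk].
      by rewrite opprK.
    by congr EFin; have := ler0n R k; lra.
  under eq_bigr do rewrite H.
  by rewrite prodEFin ltry.
apply/esym/(measure_unique G g) => //.
- apply/seteqP; split; last first.
    apply: smallest_sub; first exact: sigma_algebra_measurable.
    by move=> _ [B mB ->]; exact: measurable_rV_box.
  apply: smallest_sub; first exact: smallest_sigma_algebra.
  move=> B; rewrite -bigcup_seq => -[i _ [Y mY <-]] /=; rewrite setTI.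
  apply: sub_sigma_algebra; exists (fun j => if j == i then Y else setT).
    by move=> j; case: ifP.
  apply/seteqP; split => [x Yx j|x /(_ i)]; last by rewrite eqxx.
  by case: eqP => // ->.
- move=> _ _ [X mX ->] [Y mY ->]; exists (fun i => X i `&` Y i).
    by move=> i; exact: measurableI.
  apply/seteqP; split => [x [Xx Yx] i|x XYx]; first by split.
  by split => i; have [] := XYx i.
- by move=> k; exists (fun=> `[- k%:R, k%:R]%classic).
- apply/seteqP; split => // x _.
  (* The sum of all absolute values of coordinates bounds each of them, so a cube of this size
     contains [x]. *)
  exists (Num.truncn (\sum_i `|x ord0 i|)).+1 => // i /=.
  rewrite in_itv/= -ler_norml (le_trans _ (ltW (truncnS_gt _)))//.
  by rewrite (bigD1 i)//= lerDl sumr_ge0.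
- move=> _ [B mB ->]; rewrite mE.
  pose B' i := (fun x : measurableTypeR R => (c * x)%R :
    measurableTypeR R) @^-1` B i.
  have mB' i : measurable (B' i).
    rewrite -[X in measurable X]setTI.
    by apply: (measurable_scaleR c).
  rewrite (_ : _ @^-1` _ = rV_box B'); last first.
    by apply/seteqP; split => x /= + i => /(_ i) /=; rewrite /B' mxE.
  transitivity (\prod_i lebesgue_measure (B i))%E; first exact: lebesgue_rV_box.
  transitivity ((c ^+ n)%:E * \prod_i lebesgue_measure (B' i))%E; last first.
    by congr (_ * _)%E; apply/esym; exact: lebesgue_rV_box.
  rewrite -[n in c ^+ n]card_ord -prodr_const -prodEFin.
  by rewrite -big_split/=; apply: eq_bigr => i _;
    rewrite lebesgue_measure_scale.
Qed.

(** * Euclidean norm, cubes and balls *)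

Section euclidean_norm.
Context {R : realType} {n : nat}.
Implicit Types (x y : 'rV[R]_n) (r : R).

Lemma enorm_ge0 x : 0 <= enorm x.
Proof. exact: sqrtr_ge0. Qed.

Lemma enormZ r x : 0 <= r -> enorm (r *: x) = r * enorm x.
Proof.
move=> r0; rewrite /enorm -[in RHS](ger0_norm r0) -sqrtr_sqr -sqrtrM ?sqr_ge0//.
by rewrite mulr_sumr; congr Num.sqrt; apply: eq_bigr => i _; rewrite mxE exprMn.
Qed.

Lemma enorm0 : enorm (0 : 'rV[R]_n) = 0.
Proof. by rewrite -(scale0r 0) enormZ// mul0r. Qed.

Lemma sqr_enorm x : enorm x ^+ 2 = \sum_i x ord0 i ^+ 2.
Proof. by rewrite sqr_sqrtr// sumr_ge0// => i _; exact: sqr_ge0. Qed.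

Lemma coord_le_enorm x i : `|x ord0 i| <= enorm x.
Proof.
rewrite -sqrtr_sqr ler_wsqrtr// (bigD1 i)//= lerDl sumr_ge0// => j _.
exact: sqr_ge0.
Qed.

(* On row vectors, `|x| is the sup norm. *)
Lemma normr_rV_leP x r : 0 <= r ->
  (`|x| <= r) <-> (forall i, `|x ord0 i| <= r).
Proof.
move=> r0; rewrite [`|x|]mx_normrE; split => [/bigmax_leP[_ /= H] i|H].
  exact: (H (ord0, i)).
by apply/bigmax_leP; split => // -[i j] _; rewrite ord1.
Qed.

Lemma coord_le_normr x i : `|x ord0 i| <= `|x|.
Proof. by move: i; apply/normr_rV_leP. Qed.

Lemma normr_le_enorm x : `|x| <= enorm x.
Proof.
by apply/normr_rV_leP => [|i]; [exact: enorm_ge0|exact: coord_le_enorm].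
Qed.

(* |x|^2 - |y|^2 factors coordinatewise, and |x_i + y_i| <= |x| + |y|. *)
Lemma enorm_dist_le x y : `|enorm x - enorm y| <= n%:R * `|x - y|.
Proof.
(* The zero case is set apart because the main argument multiplies by [enorm x + enorm y] and later
   cancels it. *)
have [xy0|xy0] := eqVneq (enorm x + enorm y) 0.
  have [x0 y0] : enorm x = 0 /\ enorm y = 0.
    by have := enorm_ge0 x; have := enorm_ge0 y; split; lra.
  by rewrite x0 y0 subrr normr0 mulr_ge0.
have xy_gt0 : 0 < enorm x + enorm y by rewrite lt_neqAle eq_sym xy0 addr_ge0
  ?enorm_ge0.
rewrite -(ler_pM2r xy_gt0) -[X in _ * X <= _](ger0_norm (ltW xy_gt0)) -normrM.
rewrite -subr_sqr !sqr_enorm -sumrB (le_trans (ler_norm_sum _ _ _))//.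
apply: (@le_trans _ _ (\sum_(i < n) `|x - y| * (enorm x + enorm y)));
  last first.
  by rewrite sumr_const card_ord -[X in X <= _]mulr_natl mulrA.
apply: ler_sum => i _; rewrite subr_sqr normrM ler_pM//.
  by have := coord_le_normr (x - y) i; rewrite !mxE.
by rewrite (le_trans (ler_normD _ _))// lerD// coord_le_enorm.
Qed.

Lemma enorm_le_normr x : enorm x <= n%:R * `|x|.
Proof.
by have := enorm_dist_le x 0; rewrite enorm0 !subr0 ger0_norm// enorm_ge0.
Qed.

Lemma measurable_enorm : measurable_fun [set: 'rV[R]_n] (@enorm R n).
Proof.
apply: measurableT_comp.
  by apply: continuous_measurable_fun; exact: sqrt_continuous.
apply: measurable_sum => i; apply: measurable_funX.
exact: measurable_coord_rV.
Qed.

Lemma normr_rV_boxE y r : 0 <= r ->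
  [set x | `|x - y| <= r] =
  rV_box (fun i => `[y ord0 i - r, y ord0 i + r]%classic).
Proof.
move=> r0; apply/seteqP; split => x /=.
  by move=> /normr_rV_leP => /(_ r0) xy i /=; rewrite in_itv/= -ler_distl;
    have := xy i; rewrite !mxE.
move=> xy; apply/normr_rV_leP => // i; rewrite !mxE ler_distl.
by have := xy i; rewrite /= in_itv.
Qed.

Lemma measurable_cube y r : measurable [set x | `|x - y| <= r].
Proof.
have [r0|r0] := leP 0 r.
  by rewrite normr_rV_boxE//; apply: measurable_rV_box.
rewrite (_ : [set _ | _] = set0)//; apply/seteqP; split => // x /= xyr.
by have := le_lt_trans (le_trans (normr_ge0 _) xyr) r0; rewrite ltxx.
Qed.

Lemma lebesgue_rV_cube y r : 0 <= r ->
  lebesgue_rV R n [set x | `|x - y| <= r] = ((2 * r) ^+ n)%:E.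
Proof.
move=> r0; rewrite normr_rV_boxE//.
transitivity (\prod_(i < n)
    lebesgue_measure `[(y ord0 i - r)%R, (y ord0 i + r)%R]%classic)%E.
  exact: lebesgue_rV_box.
under eq_bigr => i _.
  have -> : (lebesgue_measure `[y ord0 i - r, y ord0 i + r]%classic :
    \bar R) = (2 * r)%:E.
    rewrite lebesgue_measure_itv/= lte_fin; case: ltP => ?.
      by rewrite -EFinD; congr EFin; lra.
    by congr EFin; lra.
  over.
by rewrite prodEFin prodr_const card_ord.
Qed.

Lemma measurable_enorm_le r : measurable [set x : 'rV[R]_n | enorm x <= r].
Proof.
rewrite -[X in measurable X]setTI.
by apply: measurable_fun_le => //; exact: measurable_enorm.
Qed.

(** [V] is the measure of the unit ball, and scaling gives the other radii. It is finite and
    positive because the unit ball lies between two cubes. *)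
Lemma lebesgue_rV_ball : exists2 V : R, 0 < V & forall r, 0 < r ->
  lebesgue_rV R n [set x : 'rV[R]_n | enorm x <= r] = (r ^+ n * V)%:E.
Proof.
pose mu := lebesgue_rV R n.
pose B := [set x : 'rV[R]_n | enorm x <= 1].
have muB_lt : (mu B <= ((2 * 1) ^+ n)%:E)%E.
  rewrite -(lebesgue_rV_cube 0 ler01) le_measure ?inE//.
  - exact: measurable_enorm_le.
  - exact: measurable_cube.
  - by move=> x /= /(le_trans (normr_le_enorm _)); rewrite subr0.
have n1 : 0 < n%:R + 1 :> R by rewrite ltr_wpDl.
(* The inner cube has half-side [1 / (n + 1)]: it fits in the unit ball since [enorm] is at most [n]
   times the sup norm, and [n + 1] stays invertible when [n = 0]. *)
have muB_gt : (((2 * (n%:R + 1)^-1) ^+ n)%:E <= mu B)%E.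
  rewrite -(@lebesgue_rV_cube 0) ?invr_ge0 ?(ltW n1)//.
  rewrite le_measure ?inE//.
  - exact: measurable_cube.
  - exact: measurable_enorm_le.
  move=> x /=; rewrite subr0 => xn;
    rewrite /B/= (le_trans (enorm_le_normr _))//.
  rewrite (le_trans (ler_wpM2l _ xn))// ler_pdivrMr// mul1r; lra.
have finB : mu B \is a fin_num.
  by rewrite ge0_fin_numE ?measure_ge0// (le_lt_trans muB_lt)// ltry.
exists (fine (mu B)).
  rewrite -lte_fin fineK//; apply: lt_le_trans muB_gt.
  by rewrite lte_fin exprn_gt0// mulr_gt0// invr_gt0.
move=> r r0; rewrite EFinM fineK// -(lebesgue_rV_scale r0
  (measurable_enorm_le r)).
congr (_ * mu _)%E; apply/seteqP; split => x /=.
all: by rewrite enormZ ?(ltW r0)// -[X in _ <= X]mulr1 ler_pM2l.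
Qed.

End euclidean_norm.

(** * Integral comparison and thin spherical shells *)

(** The integral of a nonnegative function is a supremum over the simple functions below it, and a
    larger integrand admits more of them. This allows the seminorm integrand to be compared directly
    with a measurable majorant. *)
Lemma ge0_le_integral_nomeas {d} {T : measurableType d} {R : realType}
    (mu : {measure set T -> \bar R}) (D : set T) (f g : T -> \bar R) :
  (forall x, D x -> 0 <= f x)%E -> (forall x, D x -> f x <= g x)%E ->
  (\int[mu]_(x in D) f x <= \int[mu]_(x in D) g x)%E.
Proof.
move=> f0 fg; have g0 x : D x -> (0 <= g x)%E.
  by move=> Dx; rewrite (le_trans (f0 _ Dx))// fg.
rewrite !ge0_integralE//; apply: le_ereal_sup => _ [h /= hf <-].
exists h => //= x; rewrite (le_trans (hf x))//.
by rewrite /patch; case: ifPn => // /set_mem; exact: fg.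
Qed.

Lemma measurable_shell {R : realType} n (a b : R) :
  measurable [set x : 'rV[R]_n | a < enorm x <= b].
Proof.
rewrite (_ : mkset _ = [set x | enorm x <= b] `\` [set x | enorm x <= a]).
  by apply: measurableD; exact: measurable_enorm_le.
apply/seteqP; split => x /=.
  by move=> /andP[ax ->]; split => //; apply/negP; rewrite -ltNge.
by move=> [-> /negP]; rewrite -ltNge => ->.
Qed.

(** The shell is a difference of balls, of measure [((1 + e) ^+ n - (1 - e) ^+ n) * V]. In positive
    dimension this is at least [2 * e * V]; [4 ^+ n] is a crude constant for which the upper bound
    passes through an induction. *)
Lemma measure_shell_bounds {R : realType} n : (0 < n)%N ->
  exists2 V : R, 0 < V & forall e : R, 0 < e <= 1 / 2 ->
    ((e * V)%:E <= lebesgue_rV R n [set x | (1 - e < enorm x <= 1 + e)%R] /\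
     lebesgue_rV R n [set x | (1 - e < enorm x <= 1 + e)%R]
       <= (e * (4 ^+ n * V))%:E)%E.
Proof.
move=> n0; have [V V0 VE] := @lebesgue_rV_ball R n;
  exists V => // e /andP[e0 e1].
have e1p : 0 < 1 + e by lra.
have e1m : 0 < 1 - e by lra.
have -> : [set x : 'rV[R]_n | 1 - e < enorm x <= 1 + e] =
    [set x | enorm x <= 1 + e] `\` [set x | enorm x <= 1 - e].
  apply/seteqP; split => x /=; first by move=> /andP[e1x xe1]; split => //;
    apply/negP; rewrite -ltNge.
  by move=> [-> /negP]; rewrite -ltNge => ->.
pose mu : {measure set 'rV[R]_n -> \bar R} := lebesgue_rV R n.
have muE r : 0 < r -> mu [set x | enorm x <= r] = (r ^+ n * V)%:E by exact: VE.
have muD : mu ([set x | enorm x <= 1 + e] `\` [set x | enorm x <= 1 - e]) =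
    (((1 + e) ^+ n - (1 - e) ^+ n) * V)%:E.
  rewrite measureD; [|exact: measurable_enorm_le|exact: measurable_enorm_le|].
    rewrite setIidr; last by move=> x /= xe; lra.
    apply: (etrans (congr2 (fun a b => (a - b)%E) (muE _ e1p) (muE _ e1m))).
    by rewrite -EFinB mulrBl.
  by apply: (@eq_ind_r _ _ (fun z : \bar R => z < +oo)%E _ _ (muE _ e1p));
    exact: ltry.
rewrite (muD : lebesgue_rV R n _ = _) !lee_fin mulrA !ler_pM2r//; split.
  case: n n0 {VE mu muE muD} => // n _.
  have : 1 + e <= (1 + e) ^+ n.+1.
    by rewrite exprS ler_pMr// exprn_ege1//; lra.
  have : (1 - e) ^+ n.+1 <= 1 - e.
    by rewrite exprS ger_pMr// exprn_ile1//; lra.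
  by lra.
elim: n {n0 VE mu muE muD} => [|n IH]; first by rewrite !expr0; lra.
rewrite !exprS.
have p0 : 0 <= (1 - e) ^+ n by rewrite exprn_ge0//; lra.
have p1 : (1 - e) ^+ n <= 1 by rewrite exprn_ile1//; lra.
have p2 : 1 <= 4 ^+ n :> R by rewrite exprn_ege1//; lra.
move: IH p0 p1 p2; set X := (1 + e) ^+ n; set Y := (1 - e) ^+ n;
  set Q := 4 ^+ n.
move=> XY Y0 Y1 Q1.
(* The next difference is [(1 + e) * (X - Y) + 2 * e * Y]. As [e <= 1 / 2], its terms are at most
   [3 / 2 * e * Q] and [2 * e * Q], which together stay below [4 * e * Q]. *)
have h1 : (1 + e) * (X - Y) <= (1 + e) * (e * Q) by rewrite ler_wpM2l// ltW.
have h2 : e * (e * Q) <= 1 / 2 * (e * Q).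
  by rewrite ler_wpM2r// mulr_ge0 ?(ltW e0)//; lra.
have h3 : e * Y <= e * 1 by rewrite ler_wpM2l// ltW.
have h4 : e * 1 <= e * Q by rewrite ler_wpM2l// ltW.
lra.
Qed.

(** * The tent test functions *)

Section tent.
Context {R : realType} {n : nat}.
Implicit Types (e : R) (x y : 'rV[R]_n).

Definition tent e x : R := Num.max 0 (1 - `|enorm x - 1| / e).

Lemma tent_ge0 e x : 0 <= tent e x.
Proof. by rewrite le_max lexx. Qed.

Lemma tent_le1 e x : 0 < e -> tent e x <= 1.
Proof. by move=> e0; rewrite ge_max ler01/= gerBl divr_ge0// ltW. Qed.

Lemma radial_tent e : radial (tent e).
Proof. by move=> x y; rewrite /tent => ->. Qed.

Lemma tent_neq0 e x : 0 < e -> tent e x != 0 -> 1 - e < enorm x <= 1 + e.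
Proof.
move=> e0; apply: contra_neqT => xe; apply/eqP; rewrite eq_le tent_ge0 andbT.
rewrite ge_max lexx subr_le0 ler_pdivlMr// mul1r leNgt.
by apply: contra xe; rewrite ltr_distl => /andP[-> /ltW].
Qed.

Lemma tent_ge_half e x : 0 < e -> 1 - e / 2 < enorm x <= 1 + e / 2 ->
  1 / 2 <= tent e x.
Proof.
move=> e0 xe; rewrite le_max; apply/orP; right.
have : `|enorm x - 1| / e <= 1 / 2; last by lra.
rewrite ler_pdivrMr// ler_distl; lra.
Qed.

Lemma tent_dist_le1 e x y : 0 < e -> `|tent e x - tent e y| <= 1.
Proof.
move=> e0; rewrite ler_norml.
have := tent_ge0 e x; have := tent_ge0 e y.
by have := tent_le1 x e0; have := tent_le1 y e0; lra.
Qed.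

(** Truncation at 0 does not increase distances, and the norm itself is Lipschitz. Together with the
    trivial bound by 1 this yields the factor [min(1, |h| / e)] in the seminorm estimate. *)
Lemma tent_lipschitz e x y : 0 < e ->
  `|tent e x - tent e y| <= n%:R * `|x - y| / e.
Proof.
move=> e0; apply: (@le_trans _ _ (`|enorm x - enorm y| / e)); last first.
  by rewrite ler_pM2r ?invr_gt0// enorm_dist_le.
have := lerB_dist (enorm x - 1) (enorm y - 1).
have := lerB_dist (enorm y - 1) (enorm x - 1).
rewrite (distrC (enorm y - 1)) (_ : enorm x - 1 - _ = enorm x - enorm y);
  last by ring.
have ei : 0 < e^-1 by rewrite invr_gt0.
rewrite -(ler_pM2r ei) mulrBl => ba; rewrite -(ler_pM2r ei) mulrBl => ab.
move: ba ab; rewrite /tent; set a := _ / e; set b := _ / e;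
  set c := _ / e => ba ab.
clearbody a b c; rewrite ler_norml /Num.max.
by case: ltP => h1; case: ltP => h2; apply/andP; split; lra.
Qed.

Lemma measurable_tent e : measurable_fun setT (tent e).
Proof.
apply: measurable_maxr => //; apply: measurable_funB => //.
apply: measurable_funM => //; apply: measurableT_comp => //.
by apply: measurable_funB => //; exact: measurable_enorm.
Qed.

(** The tent vanishes wherever the norm is below 1/2, which makes it admissible under the second
    assertion. *)
Lemma tent_near0 e : 0 < e <= 1 / 2 -> \forall x \near (0 :
  'rV[R]_n), tent e x = 0.
Proof.
move=> /andP[e0 e1]; have n1 : 0 < n%:R + 1 :> R by rewrite ltr_wpDl.
(* Within this radius, measured in the sup norm, [enorm x] stays below [1 / 2], hence below
   [1 - e]. *)
apply/nbhs_ballP; exists (1 / 2 / (n%:R + 1)); first by rewrite /= !divr_gt0.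
move=> x; rewrite -ball_normE/= sub0r normrN ltr_pdivlMr// => xn.
apply/eqP; apply: contraT => /(tent_neq0 e0)/andP[+ _].
have := enorm_le_normr x; have := normr_ge0 x; nra.
Qed.

Lemma compactly_supported_tent e : 0 < e -> compactly_supported (tent e).
Proof.
move=> e0; apply: bounded_closed_compact; last exact: closed_closure.
exists (1 + e); split; first exact: num_real.
move=> M eM x xcl.
have : closed [set y : 'rV[R]_n | `|y| <= M].
  apply: (@closed_comp _ _ (fun y :
    'rV[R]_n => `|y|) [set r | r <= M]) => [y _|].
    exact: norm_continuous.
  exact: closed_le.
move/closure_id => cE; suff : [set y : 'rV[R]_n | `|y| <= M] x by [].
rewrite cE; move: x xcl; apply:
  closure_subset => x /= /(tent_neq0 e0)/andP[_ xe].
by rewrite (le_trans (normr_le_enorm _))// (le_trans xe)// ltW.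
Qed.

(** The tent lies below the indicator of a shell of finite measure, so one bound serves every
    [K]. *)
Lemma locally_integrable_tent e : (0 < n)%N -> 0 < e <= 1 / 2 ->
  locally_integrable_rV (~` [set 0]) (tent e).
Proof.
move=> n0 e01; have /andP[e0 e1] := e01; split.
- by apply: measurable_funTS; exact: measurable_tent.
- by apply: closed_openC; apply: accessible_closed_set1;
    apply: hausdorff_accessible; exact: norm_hausdorff.
- move=> K _ _; 
  pose S := [set x : 'rV[R]_n | 1 - e < enorm x <= 1 + e].
  have mS : measurable S by exact: measurable_shell.
  apply: (@le_lt_trans _ _ (\int[lebesgue_rV R n]_x (\1_S x)%:E)%E).
    rewrite integral_mkcond; apply: ge0_le_integral_nomeas => x _.
      by apply: erestrict_ge0.
    rewrite /patch; case: ifPn => _; last by rewrite lee_fin.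
    rewrite lee_fin indicE ger0_norm ?tent_ge0//.
    have [->//|/(tent_neq0 e0) Sx] := eqVneq (tent e x) 0.
    by rewrite mem_set// tent_le1.
  rewrite integral_indic// setIT.
  have [V V0 /(_ _ e01)[_]] := @measure_shell_bounds R n n0.
  by move=> /le_lt_trans; apply; rewrite ltry.
Qed.

End tent.

(** * Dyadic scales and geometric series *)

Lemma exprn_powR {R : realType} (x z : R) k :
  0 <= x -> (x ^+ k) `^ z = (x `^ z) ^+ k.
Proof. by move=> x0; rewrite -!powR_mulrn ?powR_ge0// powRAC. Qed.

(** The intervals from [r] to [2 * r] tile the positive axis when [r] runs through the dyadic
    multiples of [e]. Those with [r >= e] form the first family; the shift [k.+1] makes the second
    start at [e / 2], so the two do not overlap. *)
Lemma dyadic_scale {R : realType} (e t : R) : 0 < e -> 0 < t -> exists k : nat,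
  e * 2 ^+ k < t <= 2 * (e * 2 ^+ k) \/
  e * 2^-1 ^+ k.+1 < t <= 2 * (e * 2^-1 ^+ k.+1).
Proof.
move=> e0 t0; have [te|te] := leP t e.
  have ex : exists k, e * 2^-1 ^+ k.+1 < t.
    exists (Num.truncn (e / t)); rewrite exprVn ltr_pdivrMr ?exprn_gt0//.
    rewrite mulrC -ltr_pdivrMr//; apply: lt_trans (truncnS_gt _) _.
    by rewrite -natrX ltr_nat ltn_expl.
  (* Minimality of [k] gives [t <= e / 2 ^ k]; for [k = 0] this is the case assumption [t <= e]. *)
  case: (ex_minnP ex) => k kt kmin; exists k; right; rewrite kt/=.
  rewrite exprS mulrCA mulVKf//.
  case: k kt kmin => [|k] kt kmin; first by rewrite expr0 mulr1.
  by rewrite leNgt; apply/negP => /kmin; rewrite ltnn.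
have ex : exists k, t <= 2 * (e * 2 ^+ k).
  exists (Num.truncn (t / e)); rewrite mulrCA -exprS mulrC -ler_pdivrMr//.
  rewrite (le_trans (ltW (truncnS_gt _)))// -natrX ler_nat.
  apply: (@leq_trans (2 ^ (Num.truncn (t / e)).+1)) => //.
  exact/ltnW/ltn_expl.
case: (ex_minnP ex) => k kt kmin; exists k; left; rewrite kt andbT.
case: k kt kmin => [|k] kt kmin; first by rewrite expr0 mulr1.
rewrite ltNge; apply/negP => H.
have : t <= 2 * (e * 2 ^+ k) by rewrite mulrCA -exprS.
by move=> /kmin; rewrite ltnn.
Qed.

Lemma nneseries_le_geometric {R : realType} (f : nat -> \bar R) (K th : R) :
  0 <= K -> 0 <= th < 1 -> (forall k, 0 <= f k <= (K * th ^+ k)%:E)%E ->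
  (\sum_(k <oo) f k <= (K / (1 - th))%:E)%E.
Proof.
move=> K0 /andP[th0 th1] fK; apply: lime_le.
  by apply: is_cvg_nneseries => k _ _; have /andP[] := fK k.
apply: nearW => m; apply: (@le_trans _ _ (\sum_(0 <= k < m)
  (K * th ^+ k)%:E)%E).
  by apply: lee_sum => k _; have /andP[] := fK k.
rewrite sumEFin lee_fin -mulr_sumr ler_wpM2l// big_mkord.
have th1' : 0 < 1 - th by lra.
rewrite -(ler_pM2r th1') mulVf ?gt_eqF// mulrC.
have := subrX1 th m => H.
have : 0 <= th ^+ m by rewrite exprn_ge0.
lra.
Qed.

(** * Pairs of nearby points with one member in a given set *)

Section near_diagonal.
Context {R : realType} {n : nat}.
Implicit Types (S : set 'rV[R]_n) (r : R).

(** These are the pairs at distance at most [r] on which the difference of a function supported in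
    [S] can be nonzero. *)
Definition near_diagonal S r : set ('rV[R]_n * 'rV[R]_n) :=
  [set z | (S z.1 \/ S z.2) /\ `|z.1 - z.2| <= r].

Let mu := lebesgue_rV R n.

Lemma measurable_rV_sub :
  measurable_fun setT (fun z : 'rV[R]_n * 'rV[R]_n => z.1 - z.2).
Proof.
apply: measurable_fun_rV => i.
rewrite (_ : _ \o _ = (fun z => coord_rV i z.1 - coord_rV i z.2 : R));
  last first.
  by apply/funext => z /=; rewrite /coord_rV !mxE.
apply: measurable_funB.
  exact: measurableT_comp (measurable_coord_rV i) measurable_fst.
exact: measurableT_comp (measurable_coord_rV i) measurable_snd.
Qed.

Lemma measurable_dist_le r :
  measurable [set z : 'rV[R]_n * 'rV[R]_n | `|z.1 - z.2| <= r].
Proof.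
rewrite (_ : mkset _ =
  (fun z => z.1 - z.2) @^-1` [set x : 'rV[R]_n | `|x - 0| <= r]); last first.
  by apply/seteqP; split => z /=; rewrite subr0.
rewrite -[X in measurable X]setTI; apply: measurable_rV_sub => //.
exact: measurable_cube.
Qed.

Lemma measurable_near_diagonal S r : measurable S ->
  measurable (near_diagonal S r).
Proof.
move=> mS; rewrite (_ : near_diagonal S r = (fst @^-1` S `|` snd @^-1` S) `&`
  [set z | `|z.1 - z.2| <= r])//.
apply: measurableI; last exact: measurable_dist_le.
apply: measurableU; rewrite -[X in measurable X]setTI.
  exact: measurable_fst.
exact: measurable_snd.
Qed.

(** By Tonelli: once the point in [S] is fixed, the other ranges over a cube of side [2 * r]. The
    leading 2 accounts for either point being the one in [S]. *)
Lemma near_diagonal_measure_le S r : measurable S -> 0 <= r ->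
  ((mu \x mu) (near_diagonal S r) <= (2 * (2 * r) ^+ n)%:E * mu S)%E.
Proof.
move=> mS r0; have r20 : 0 <= (2 * r) ^+ n by rewrite exprn_ge0// mulr_ge0.
pose E1 : set ('rV[R]_n * 'rV[R]_n) :=
  fst @^-1` S `&` [set z | `|z.1 - z.2| <= r].
pose E2 : set ('rV[R]_n * 'rV[R]_n) :=
  snd @^-1` S `&` [set z | `|z.1 - z.2| <= r].
have mE1 : measurable E1.
  apply: measurableI; last exact: measurable_dist_le.
  by rewrite -[X in measurable X]setTI; exact: measurable_fst.
have mE2 : measurable E2.
  apply: measurableI; last exact: measurable_dist_le.
  by rewrite -[X in measurable X]setTI; exact: measurable_snd.
have -> : near_diagonal S r = E1 `|` E2 by rewrite -setIUl.
apply: le_trans (measureU2 _ mE1 mE2) _.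
have mind (E : set ('rV[R]_n * 'rV[R]_n)) : measurable E ->
    measurable_fun setT (fun z => (\1_E z)%:E : \bar R).
  by move=> mE; apply/measurable_EFinP; exact: measurable_indic.
have ind0 (E : set ('rV[R]_n * 'rV[R]_n)) z : (0 <= (\1_E z)%:E :> \bar R)%E.
  by rewrite lee_fin.
have slice (F : 'rV[R]_n -> R) y :
    (forall x, F x = \1_S y * \1_[set x | `|x - y| <= r] x) ->
    (\int[mu]_x (F x)%:E = ((2 * r) ^+ n)%:E * (\1_S y)%:E)%E.
  move=> FE; under eq_integral do rewrite FE EFinM.
  rewrite ge0_integralZl//; last first.
    by apply/measurable_EFinP; apply: measurable_indic; exact: measurable_cube.
  rewrite integral_indic ?setIT//; last exact: measurable_cube.
  by rewrite muleC; congr (_ * _)%E; exact: lebesgue_rV_cube.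
have outer : (\int[mu]_y (((2 * r) ^+ n)%:E * (\1_S y)%:E) =
    ((2 * r) ^+ n)%:E * mu S)%E.
  rewrite ge0_integralZl//; last first.
    by apply/measurable_EFinP; exact: measurable_indic.
  by rewrite integral_indic ?setIT.
have E1E : (mu \x mu)%E E1 = (((2 * r) ^+ n)%:E * mu S)%E.
  rewrite -(setIT E1) -integral_indic// fubini_tonelli1//; last exact: mind.
  rewrite -outer; apply: eq_integral => x _; apply: slice => y.
  by rewrite !indicE -natrM mulnb in_setI; congr ((_ && _)%:R);
    apply/idP/idP; rewrite !inE/= distrC.
have E2E : (mu \x mu)%E E2 = (((2 * r) ^+ n)%:E * mu S)%E.
  rewrite -(setIT E2) -integral_indic// fubini_tonelli2//; last exact: mind.
  rewrite -outer; apply: eq_integral => y _; apply: slice => x.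
  by rewrite !indicE -natrM mulnb in_setI; congr ((_ && _)%:R);
    apply/idP/idP; rewrite !inE/=.
set c := (2 * r) ^+ n in E1E E2E *.
apply: (@le_trans _ _ (c%:E * mu S + c%:E * mu S)%E).
  by apply: leeD; [rewrite -E1E|rewrite -E2E]; exact: lexx.
by rewrite -ge0_muleDl ?lee_fin// -EFinD (_ : c + c = 2 * c)//; lra.
Qed.

(** Here [a k] plays the role of a bound on the integrand at scale [rho k]. Integrating term by term
    turns the decay of its product with the cube volume into a convergent geometric series. *)
Lemma near_diagonal_series_le S (a rho : nat -> R) (K th : R) :
  measurable S -> (forall k, 0 <= a k) -> (forall k, 0 <= rho k) ->
  0 <= K -> 0 <= th < 1 ->
  (forall k, a k * (2 * rho k) ^+ n <= K * th ^+ k) ->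
  (mu S < +oo)%E ->
  (\int[mu \x mu]_z \sum_(k <oo) (a k * \1_(near_diagonal S (rho k)) z)%:E
    <= (2 * K / (1 - th))%:E * mu S)%E.
Proof.
move=> mS a0 rho0 K0 th01 aK Sfin.
have th1 : 0 < 1 - th by case/andP: th01; lra.
rewrite integral_nneseries//; last 2 first.
- move=> k; apply/measurable_EFinP; apply: measurable_funM => //.
  by apply: measurable_indic; exact: measurable_near_diagonal.
- by move=> k z _; rewrite lee_fin mulr_ge0.
have muS : mu S = (fine (mu S))%:E by rewrite fineK// ge0_fin_numE.
have muS0 : 0 <= fine (mu S) by rewrite fine_ge0.
rewrite muS -EFinM mulrAC.
apply: nneseries_le_geometric => //; first by rewrite !mulr_ge0.
move=> k; have -> : (\int[mu \x mu]_z (a k * \1_(near_diagonal S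
  (rho k)) z)%:E =
    (a k)%:E * (mu \x mu) (near_diagonal S (rho k)))%E.
  under eq_integral do rewrite EFinM.
  have mD := measurable_near_diagonal (rho k) mS.
  rewrite ge0_integralZl_EFin//; first by rewrite integral_indic ?setIT.
  by apply/measurable_EFinP; exact: measurable_indic.
apply/andP; split; first by rewrite mule_ge0// lee_fin.
apply: (@le_trans _ _ ((a k)%:E * ((2 * (2 * rho k) ^+ n)%:E * mu S))%E).
  by rewrite lee_wpmul2l ?lee_fin//; exact: near_diagonal_measure_le.
rewrite muS -!EFinM lee_fin mulrCA mulrA; have := ler_wpM2r muS0 (aK k).
nra.
Qed.

End near_diagonal.

(** * Bounds on real powers *)

(** In logarithms the claim is [|z * ln r| <= |z| * ln L], which treats both signs of [z] at
    once. *)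
Lemma powR_weight_bounds {R : realType} (L r z : R) :
  1 <= L -> L^-1 <= r <= L ->
  L `^ (- `|z|) <= r `^ z <= L `^ `|z|.
Proof.
move=> L1 /andP[Lr rL]; have L0 : 0 < L by lra.
have r0 : 0 < r by rewrite (lt_le_trans _ Lr)// invr_gt0.
have lrL : `|ln r| <= ln L.
  by rewrite ler_norml -lnV// !ler_ln// ?posrE ?invr_gt0// Lr.
have : `|z * ln r| <= `|z| * ln L by rewrite normrM ler_wpM2l.
rewrite ler_norml => /andP[zl zr].
by rewrite /powR !gt_eqF// !ler_expR mulNr zl zr.
Qed.

Lemma powR_gt1 {R : realType} (x z : R) : 1 < x -> 0 < z -> 1 < x `^ z.
Proof.
move=> x1 z0; have x0 : 0 < x by rewrite (lt_trans _ x1).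
have h : 1 `^ z = 1 by rewrite powR1.
by rewrite -[ltLHS]h gt0_ltr_powR// nnegrE ltW.
Qed.

Lemma powR_lt1 {R : realType} (x z : R) :
  0 <= x -> x < 1 -> 0 < z -> x `^ z < 1.
Proof.
move=> x0 x1 z0; have h : 1 `^ z = 1 by rewrite powR1.
by rewrite -[ltRHS]h gt0_ltr_powR// nnegrE.
Qed.

Lemma sobolev_integrand_ge0 {R : realType} n (s p alpha Lambda : R)
    (u : 'rV[R]_n -> R) x y : 0 <= sobolev_integrand s p alpha Lambda u x y.
Proof.
by rewrite /sobolev_integrand !mulr_ge0 ?invr_ge0 ?powR_ge0// /chi ler0n.
Qed.

(** * Upper bound for the seminorm of the tent *)

Section sobolev_seminorm_tent.
Context {R : realType} {n : nat}.
Variables (s p alpha Lambda : R).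
Hypotheses (n_gt0 : (0 < n)%N) (s_gt0 : 0 < s) (s_lt1 : s < 1) (p_gt1 : 1 < p).
Hypothesis Lambda_gt1 : 1 < Lambda.

Let mu := lebesgue_rV R n.
Let p0 : 0 < p. Proof. exact: lt_trans p_gt1. Qed.
Let M := (2 * Lambda) `^ `|alpha * p|.
Let M0 : 0 < M.
Proof. by rewrite powR_gt0 ?mulr_gt0 ?(lt_trans _ Lambda_gt1). Qed.
Let shell (e : R) := [set x : 'rV[R]_n | 1 - e < enorm x <= 1 + e].
(* Bounds the integrand where r < `|x - y| <= 2 * r. *)
Let coef (e r : R) := M * (Num.min 1 (2 * n%:R * r / e) `^ p / r `^
  (n%:R + s * p)).

Let coef_ge0 e r : 0 <= coef e r.
Proof. by rewrite mulr_ge0 ?(ltW M0)// divr_ge0 ?powR_ge0. Qed.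

(** If neither point is in the shell, both tents vanish. Otherwise three factors are bounded
    separately: the weight by [M], the difference by both 1 and the Lipschitz bound, and the kernel
    by its value at [r]. *)
Lemma sobolev_integrand_tent_le (e r : R) (x y : 'rV[R]_n) :
  0 < e <= 1 / 2 -> 0 < r -> r < `|x - y| <= 2 * r ->
  sobolev_integrand s p alpha Lambda (tent e) x y <=
    coef e r * \1_(near_diagonal (shell e) (2 * r)) (x, y).
Proof.
move=> /andP[e0 e1] r0 /andP[rxy xyr].
rewrite /sobolev_integrand indicE.
have [Sxy|nSxy] := pselect (shell e x \/ shell e y); last first.
  have bx z : ~ shell e z -> tent e z = 0.
    by move=> Sz; apply: contra_notP Sz => /eqP /(tent_neq0 e0).
  rewrite !bx ?subrr ?normr0 ?powR0 ?gt_eqF// ?mul0r; [|tauto|tauto].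
  by rewrite mulr_ge0.
have -> : ((x, y) \in near_diagonal (shell e) (2 * r)) = true by apply/mem_set.
rewrite [(nat_of_bool true)%:R]mulr1n mulr1 /coef /chi.
case: andP => [[yx1 yx2]|_]; last first.
  by rewrite mulr0 mulr_ge0 ?(ltW M0)// divr_ge0 ?powR_ge0.
rewrite mulr1 [_ * enorm x `^ _]mulrC -[leLHS]mulrA.
have L1 := Lambda_gt1.
have L0 : 0 < Lambda by lra.
(* Points of the shell have norm between 1/2 and 3/2. If only [y] is such a point, the cut-off
   transfers this to [x] at the cost of a factor [Lambda]. *)
have /andP[xL1 xL2] : (2 * Lambda)^-1 <= enorm x <= 2 * Lambda.
  have yx1' : enorm x <= Lambda * enorm y by rewrite -ler_pdivrMl.
  rewrite invfM -(ler_pM2r L0) -mulrA mulVf ?gt_eqF// mulr1.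
  move: Sxy; rewrite /shell/=; case=> /andP[h1 h2]; apply/andP; split; nra.
apply: ler_pM.
- exact: powR_ge0.
- by rewrite divr_ge0 ?powR_ge0.
- by have /andP[] := @powR_weight_bounds _ (2 * Lambda) (enorm x)
    (alpha * p) ltac:(lra) ltac:(lra).
have nr : 0 <= 2 * n%:R * r / e by rewrite divr_ge0 ?mulr_ge0// ltW.
apply: ler_pM; rewrite ?invr_ge0 ?powR_ge0//.
  apply: ge0_ler_powR; rewrite ?nnegrE ?(ltW p0)// ?le_min ?ler01//.
  rewrite tent_dist_le1//= (le_trans (tent_lipschitz _ _ e0))//.
  rewrite ler_pM2r ?invr_gt0// -mulrA mulrCA; exact: ler_wpM2l.
have rp : 0 < r `^ (n%:R + s * p) by exact: powR_gt0.
rewrite lef_pV2 ?posrE ?powR_gt0//; last first.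
  by rewrite (lt_le_trans r0)// (le_trans (ltW rxy))// normr_le_enorm.
apply: ge0_ler_powR; rewrite ?nnegrE ?enorm_ge0 ?(ltW r0)//.
  by rewrite addr_ge0// mulr_ge0 ?(ltW s_gt0) ?(ltW p0).
by rewrite (le_trans (ltW rxy))// normr_le_enorm.
Qed.

(* The dyadic radii at least e, and those below e. *)
Let up (e : R) k := e * 2 ^+ k.
Let down (e : R) k := e * 2^-1 ^+ k.+1.
Let part (e : R) (rad : nat -> R) (z : 'rV[R]_n * 'rV[R]_n) : \bar R :=
  (\sum_(k <oo) (coef e (rad k) * \1_(near_diagonal (shell e)
    (2 * rad k)) z)%:E)%E.

Let part_ge0 e rad z : (0 <= part e rad z)%E.
Proof. by apply: nneseries_ge0 => k _ _; rewrite lee_fin mulr_ge0. Qed.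

Let part_ge_term e rad z k :
  ((coef e (rad k) * \1_(near_diagonal (shell e) (2 * rad k)) z)%:E <=
   part e rad z)%E.
Proof.
have := @nneseries_lim_ge R (fun k => (coef e (rad k) *
  \1_(near_diagonal (shell e) (2 * rad k)) z)%:E) xpredT 0%N k.+1.
rewrite big_nat_recr//=; move=> H; apply: le_trans (H _).
  by rewrite leeDr// sume_ge0// => i _; rewrite lee_fin mulr_ge0.
by move=> i _ _; rewrite lee_fin mulr_ge0.
Qed.

(** A pair of distinct points belongs to some dyadic scale, and the single term of that scale
    already dominates the integrand. *)
Let sobolev_integrand_tent_le_parts e x y : 0 < e <= 1 / 2 ->
  ((sobolev_integrand s p alpha Lambda (tent e) x y)%:E <=
   part e (up e) (x, y) + part e (down e) (x, y))%E.
Proof.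
move=> e01; have /andP[e0 _] := e01.
have [->|xy] := eqVneq x y.
  rewrite /sobolev_integrand subrr normr0 powR0 ?gt_eqF// !mul0r.
  by rewrite adde_ge0.
have t0 : 0 < `|x - y| by rewrite normr_gt0 subr_eq0.
have [k [kxy|kxy]] := dyadic_scale e0 t0.
  apply: (@le_trans _ _ (part e (up e) (x, y))); last by rewrite leeDl.
  apply: le_trans (part_ge_term _ _ _ k); rewrite lee_fin.
  by apply: sobolev_integrand_tent_le => //; rewrite mulr_gt0 ?exprn_gt0.
apply: (@le_trans _ _ (part e (down e) (x, y))); last by rewrite leeDr.
apply: le_trans (part_ge_term _ _ _ k); rewrite lee_fin.
by apply: sobolev_integrand_tent_le => //;
  rewrite mulr_gt0 ?exprn_gt0 ?invr_gt0.
Qed.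

Let measurable_part e rad : measurable_fun setT (part e rad).
Proof.
apply: ge0_emeasurable_sum => [k z _ _|k _]; first by rewrite lee_fin mulr_ge0.
apply/measurable_EFinP; apply: measurable_funM => //.
apply: measurable_indic; apply: measurable_near_diagonal.
exact: measurable_shell.
Qed.

(** The volume of the cube cancels the power [r ^+ n] in the kernel; what remains is geometric along
    dyadic radii. *)
Let coef_volume e r : 0 < r ->
  coef e r * (2 * (2 * r)) ^+ n =
  M * 4 ^+ n * (Num.min 1 (2 * n%:R * r / e) `^ p * r `^ (- (s * p))).
Proof.
move=> r0; rewrite /coef powRD; last by rewrite (gt_eqF r0) implybT.
rewrite powR_mulrn ?(ltW r0)// powRN (_ : 2 * (2 * r) = 4 * r); last by ring.
have : r ^+ n != 0 by rewrite expf_neq0// gt_eqF.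
have : r `^ (s * p) != 0 by rewrite gt_eqF// powR_gt0.
by rewrite exprMn; move=> h1 h2; field; rewrite h1.
Qed.

(** Scale [r] contributes at most a multiple of [e * min(1, r / e)^p * r^(-s p)]. Above [e] this
    decays because [s > 0], and below [e] it decays towards 0 like [r^(p - s p)] because [s < 1].
    Both sums are thus of order [e^(1 - s p)], and a [p]-th root remains to be taken. *)
Lemma sobolev_seminorm_tent_le : exists2 C : R, 0 < C &
  forall e, 0 < e <= 1 / 2 ->
    (sobolev_seminorm s p alpha Lambda setT (tent e : 'rV[R]_n -> R)
      <= (C * e `^ (p^-1 - s))%:E)%E.
Proof.
(* [th1] and [th2] are the ratios of the series over large and small radii. In [K2], the power of
   [n] comes from the Lipschitz constant and the last factor from the small radii starting at
   [e / 2]. *)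
pose th1 : R := 2 `^ (- (s * p)).
pose th2 : R := 2^-1 `^ (p - s * p).
pose K2 : R := M * 4 ^+ n * (n%:R `^ p * 2^-1 `^ (- (s * p))).
have [V V0 VE] := @measure_shell_bounds R n n_gt0.
pose C : R := (2 * (M * 4 ^+ n) / (1 - th1) + 2 * K2 / (1 - th2)) *
  (4 ^+ n * V).
have th1_01 : 0 <= th1 < 1.
  rewrite /th1 powR_ge0/= powRN invf_lt1 ?powR_gt0//.
  by apply: powR_gt1; [rewrite ltr1n|exact: mulr_gt0].
have th2_01 : 0 <= th2 < 1.
  rewrite /th2 powR_ge0/=; apply: powR_lt1; rewrite ?invf_lt1 ?ltr1n//.
  by rewrite subr_gt0 -[ltRHS]mul1r ltr_pM2r.
have K20 : 0 <= K2 by rewrite !mulr_ge0 ?powR_ge0 ?(ltW M0)// exprn_ge0.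
have th1' : 0 < 1 - th1 by rewrite subr_gt0; case/andP: th1_01.
have th2' : 0 < 1 - th2 by rewrite subr_gt0; case/andP: th2_01.
have M40 : 0 < M * 4 ^+ n by rewrite mulr_gt0// exprn_gt0.
have V40 : 0 < 4 ^+ n * V by rewrite mulr_gt0// exprn_gt0.
have C0 : 0 < C.
  apply: mulr_gt0 => //; apply: ltr_wpDr.
    by apply: divr_ge0; [exact: mulr_ge0|exact: ltW].
  by apply: divr_gt0 => //; exact: mulr_gt0.
exists (C `^ p^-1); first exact: powR_gt0.
move=> e e01; have /andP[e0 e1] := e01.
have [_ muSe] := VE e e01.
have mSe : measurable (shell e) by exact: measurable_shell.
have muSfin : (mu (shell e) < +oo)%E by apply: le_lt_trans muSe _; rewrite ltry.
have up0 k : 0 < up e k by rewrite mulr_gt0// exprn_gt0.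
have down0 k : 0 < down e k by rewrite mulr_gt0// exprn_gt0 ?invr_gt0.
pose E := e `^ (- (s * p)).
have E0 : 0 < E by exact: powR_gt0.
have partU : (\int[mu \x mu]_z part e (up e) z <=
    (2 * (M * 4 ^+ n * E) / (1 - th1))%:E * mu (shell e))%E.
  apply: near_diagonal_series_le => //.
  - by move=> k; rewrite mulr_ge0// ltW.
  - by rewrite !mulr_ge0 ?(ltW M0) ?(ltW E0) ?exprn_ge0.
  - move=> k; rewrite coef_volume// -[leRHS]mulrA ler_wpM2l//.
      by rewrite mulr_ge0 ?(ltW M0)// exprn_ge0.
    rewrite [in X in _ * X]/up powRM ?exprn_ge0 ?(ltW e0)// exprn_powR//.
    rewrite -[leRHS]mul1r ler_wpM2r//.
      by rewrite mulr_ge0 ?powR_ge0// exprn_ge0// powR_ge0.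
    (* At large radii the minimum is simply bounded by 1. *)
    have h1 : 1 `^ p = 1 by rewrite powR1.
    rewrite -[leRHS]h1 ge0_ler_powR ?nnegrE ?(ltW p0)//; last first.
      by rewrite ge_min lexx.
    by rewrite le_min ler01/= divr_ge0 ?mulr_ge0 ?(ltW e0) ?(ltW (up0 _)).
have partD : (\int[mu \x mu]_z part e (down e) z <=
    (2 * (K2 * E) / (1 - th2))%:E * mu (shell e))%E.
  apply: near_diagonal_series_le => //.
  - by move=> k; rewrite mulr_ge0// ltW.
  - by rewrite mulr_ge0// ltW.
  - move=> k; rewrite coef_volume//.
    (* The shift [k.+1] in [down] absorbs the factor 2. *)
    have -> : 2 * n%:R * down e k / e = n%:R * 2^-1 ^+ k.
      by rewrite /down exprS; field; rewrite gt_eqF.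
    have hk : 0 <= 2^-1 ^+ k :> R by rewrite exprn_ge0.
    rewrite /K2 -!mulrA ler_wpM2l ?(ltW M0)// ler_wpM2l ?exprn_ge0//.
    have -> : th2 = 2^-1 `^ p * 2^-1 `^ (- (s * p)).
      by rewrite /th2 powRD// invr_eq0 pnatr_eq0 implybT.
    rewrite [in X in _ * X]/down powRM ?exprn_ge0 ?(ltW e0)// exprn_powR//.
    apply: (@le_trans _ _ ((n%:R `^ p * (2^-1 `^ p) ^+ k) *
        (e `^ (- (s * p)) * (2^-1 `^ (- (s * p))) ^+ k.+1))).
      rewrite ler_wpM2r ?mulr_ge0 ?powR_ge0 ?exprn_ge0 ?powR_ge0//.
      have nh : 0 <= n%:R * 2^-1 ^+ k :> R by rewrite mulr_ge0.
      rewrite -exprn_powR// -powRM//; apply: ge0_ler_powR;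
        rewrite ?nnegrE ?(ltW p0)//.
      by rewrite ge_min lexx orbT.
    by rewrite exprMn exprS -/E le_eqVlt; apply/orP; left; apply/eqP; ring.
have total : (\int[mu]_y \int[mu]_x
    (sobolev_integrand s p alpha Lambda (tent e) x y)%:E <=
    (C * e `^ (1 - s * p))%:E)%E.
  apply: (@le_trans _ _ (\int[mu]_y \int[mu]_x
      (part e (up e) (x, y) + part e (down e) (x, y)))%E).
    apply: ge0_le_integral_nomeas => y _.
      apply: integral_ge0 => x _; rewrite lee_fin; exact: sobolev_integrand_ge0.
    apply: ge0_le_integral_nomeas => x _;
      last exact: sobolev_integrand_tent_le_parts.
    by rewrite lee_fin; exact: sobolev_integrand_ge0.
  (* Tonelli is applied to the majorant, whose measurability is established; the second form matches
     the order of integration in the seminorm. *)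
  rewrite -(fubini_tonelli2 (fun z =>
    part e (up e) z + part e (down e) z)%E)//; last 2 first.
    by apply: emeasurable_funD; exact: measurable_part.
    by move=> z; rewrite adde_ge0.
  rewrite ge0_integralD//.
  apply: le_trans (leeD partU partD) _.
  set a := 2 * _ / _; set b := 2 * _ / _.
  have a0 : 0 <= a.
    by apply: divr_ge0; [rewrite !mulr_ge0// ltW|exact: ltW].
  have b0 : 0 <= b.
    by apply: divr_ge0; [rewrite !mulr_ge0// ltW|exact: ltW].
  rewrite -ge0_muleDl ?lee_fin// -EFinD.
  apply: (@le_trans _ _ ((a + b)%:E * (e * (4 ^+ n * V))%:E)%E).
    by rewrite lee_wpmul2l// lee_fin addr_ge0.
  rewrite -EFinM lee_fin powRD; last by rewrite (gt_eqF e0) implybT.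
  rewrite powRr1 ?(ltW e0)// -/E /a /b /C le_eqVlt; apply/orP; left.
  by apply/eqP; ring.
rewrite /sobolev_seminorm.
apply: (le_trans (gt0_ler_poweR _ _ _ total)).
- by rewrite invr_ge0 ltW.
- rewrite in_itv/= leey andbT; apply: integral_ge0 => y _.
  by apply: integral_ge0 => x _; rewrite lee_fin; exact: sobolev_integrand_ge0.
- by rewrite in_itv/= leey andbT lee_fin mulr_ge0 ?powR_ge0// ltW.
rewrite poweR_EFin powRM ?powR_ge0 ?(ltW C0)// -powRrM.
by rewrite (_ : (1 - s * p) * p^-1 = p^-1 - s)//; field; rewrite gt_eqF.
Qed.

End sobolev_seminorm_tent.

(** * Weighted Lebesgue norms of the tent *)

Section weighted_norm_tent.
Context {R : realType} {n : nat}.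
Hypothesis n_gt0 : (0 < n)%N.

Let mu := lebesgue_rV R n.

(** On the shell the norm lies between 1/2 and 2, so the weight is at most [2 ^ |beta|], while the
    tent is at most 1. *)
Lemma weighted_norm_tent_le (beta q : R) : 0 < q ->
  exists2 C : R, 0 < C & forall e, 0 < e <= 1 / 2 ->
    (weighted_norm beta q (tent e : 'rV[R]_n -> R) <= (C * e `^ q^-1)%:E)%E.
Proof.
move=> q0; have [V V0 VE] := @measure_shell_bounds R n n_gt0.
pose W : R := (2 `^ `|beta|) `^ q.
have W0 : 0 < W by rewrite !powR_gt0.
have V40 : 0 < 4 ^+ n * V by rewrite mulr_gt0// exprn_gt0.
exists ((W * (4 ^+ n * V)) `^ q^-1); first by rewrite powR_gt0// mulr_gt0.
move=> e e01; have /andP[e0 e1] := e01; have [_ muS] := VE e e01.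
have WV : 0 <= W * (4 ^+ n * V) by rewrite ltW// mulr_gt0.
rewrite /weighted_norm unlock -powRM ?(ltW e0)//.
rewrite -poweR_EFin; apply: gt0_ler_poweR.
- by rewrite invr_ge0 ltW.
- by rewrite in_itv/= leey andbT integral_ge0// => x _; exact: poweR_ge0.
- by rewrite in_itv/= leey andbT lee_fin mulr_ge0// ltW.
pose S := [set x : 'rV[R]_n | 1 - e < enorm x <= 1 + e].
have mS : measurable S by exact: measurable_shell.
apply: (@le_trans _ _ (\int[mu]_x (W%:E * (\1_S x)%:E))%E).
  apply: ge0_le_integral_nomeas => x _; first exact: poweR_ge0.
  rewrite abse_EFin poweR_EFin -EFinM lee_fin indicE.
  have [->|/(tent_neq0 e0) Sx] := eqVneq (tent e x) 0.
    by rewrite mulr0 normr0 powR0 ?gt_eqF// mulr_ge0// ltW.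
  rewrite (mem_set (_ : S x))// mulr1.
  rewrite ger0_norm ?mulr_ge0 ?powR_ge0 ?tent_ge0//.
  apply: ge0_ler_powR; rewrite ?nnegrE ?(ltW q0) ?powR_ge0 ?mulr_ge0 ?tent_ge0
    ?powR_ge0//.
  rewrite -[leRHS]mulr1 ler_pM ?powR_ge0 ?tent_ge0 ?tent_le1//.
  have /andP[] := @powR_weight_bounds _ 2 (enorm x) beta ltac:(lra) ltac:(lra).
  by [].
rewrite ge0_integralZl_EFin ?(ltW W0)//; last first.
  by apply/measurable_EFinP; exact: measurable_indic.
rewrite integral_indic// setIT.
have -> : W * (4 ^+ n * V) * e = W * (e * (4 ^+ n * V)) by ring.
by rewrite EFinM; apply: lee_wpmul2l; [rewrite lee_fin ltW|exact: muS].
Qed.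

(** Only the shell of half the thickness is kept: there the tent is at least 1/2 and the weight at
    least [2 ^ (- |gamma|)]. *)
Lemma weighted_norm_tent_ge (gamma tau : R) : 0 < tau ->
  exists2 c : R, 0 < c & forall e, 0 < e <= 1 / 2 ->
    ((c * e `^ tau^-1)%:E <= weighted_norm gamma tau (tent e :
      'rV[R]_n -> R))%E.
Proof.
move=> tau0; have [V V0 VE] := @measure_shell_bounds R n n_gt0.
pose W : R := (2 `^ (- `|gamma|) * (1 / 2)) `^ tau.
have W0 : 0 < W by rewrite powR_gt0// mulr_gt0// powR_gt0.
exists ((W * (V / 2)) `^ tau^-1);
  first by rewrite powR_gt0// mulr_gt0// divr_gt0.
move=> e e01; have /andP[e0 e1] := e01.
have [|muS _] := VE (e / 2); first lra.
have WV : 0 <= W * (V / 2) by rewrite ltW// mulr_gt0// divr_gt0.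
rewrite /weighted_norm unlock -powRM ?(ltW e0)//.
rewrite -poweR_EFin; apply: gt0_ler_poweR.
- by rewrite invr_ge0 ltW.
- by rewrite in_itv/= leey andbT lee_fin mulr_ge0// ltW.
- by rewrite in_itv/= leey andbT integral_ge0// => x _; exact: poweR_ge0.
pose S := [set x : 'rV[R]_n | 1 - e / 2 < enorm x <= 1 + e / 2].
have mS : measurable S by exact: measurable_shell.
apply: (@le_trans _ _ (\int[mu]_x (W%:E * (\1_S x)%:E))%E).
  rewrite ge0_integralZl_EFin ?(ltW W0)//; last first.
    by apply/measurable_EFinP; exact: measurable_indic.
  rewrite integral_indic// setIT.
  have -> : W * (V / 2) * e = W * (e / 2 * V) by ring.
  by rewrite EFinM; apply: lee_wpmul2l; [rewrite lee_fin ltW|exact: muS].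
apply: ge0_le_integral_nomeas => x _.
  by rewrite -EFinM lee_fin mulr_ge0// ltW.
rewrite abse_EFin poweR_EFin -EFinM lee_fin indicE.
have [Sx|nSx] := pselect (S x); last by rewrite memNset// mulr0 powR_ge0.
rewrite (mem_set Sx) mulr1.
rewrite ger0_norm ?mulr_ge0 ?powR_ge0 ?tent_ge0//.
have Sx' : 1 - e / 2 < enorm x <= 1 + e / 2 by exact: Sx.
apply: ge0_ler_powR; rewrite ?nnegrE ?(ltW tau0) ?mulr_ge0 ?tent_ge0
  ?powR_ge0//.
rewrite ler_pM ?powR_ge0//; last exact: tent_ge_half.
by have /andP[] := @powR_weight_bounds _ 2
  (enorm x) gamma ltac:(lra) ltac:(lra).
Qed.

End weighted_norm_tent.

(** * Comparison of exponents as the shell shrinks *)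

(** For positive [th] the right-hand side would tend to 0 with [e]. *)
Lemma powR_le_exponent_le0 {R : realType} (c C th : R) : 0 < c -> 0 < C ->
  (forall e, 0 < e <= 1 / 2 -> c <= C * e `^ th) -> th <= 0.
Proof.
move=> c0 C0 H; rewrite leNgt; apply/negP => th0.
have x0 : 0 < c / (2 * C) by rewrite divr_gt0// mulr_gt0.
(* This choice forces [C * e ^ th] down to at most [c / 2]. *)
pose e := Num.min (1 / 2) ((c / (2 * C)) `^ th^-1).
have e0 : 0 < e by rewrite lt_min powR_gt0// andbT; lra.
have : c <= C * e `^ th by apply: H; rewrite e0 ge_min lexx.
have : e `^ th <= c / (2 * C).
  have -> : c / (2 * C) = ((c / (2 * C)) `^ th^-1) `^ th.
    by rewrite -powRrM mulVf ?gt_eqF// powRr1// ltW.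
  apply: ge0_ler_powR; rewrite ?nnegrE ?powR_ge0 ?(ltW th0) ?(ltW e0)//.
  by rewrite ge_min lexx orbT.
move=> /(ler_wpM2l (ltW C0)); have -> : C * (c / (2 * C)) = c / 2.
  by field; rewrite gt_eqF.
lra.
Qed.

Theorem proposition3p1 (R : realType) (d : nat)
    (s p q tau a alpha beta gamma sigma Lambda : R)
    (hd : (2 <= d)%N) (hs0 : 0 < s) (hs1 : s < 1) (hp : 1 < p)
    (hq : 1 <= q) (htau : 1 <= tau) (ha0 : 0 < a) (ha1 : a <= 1)
    (hLambda : 1 < Lambda)
    (hsigma : gamma = a * sigma + (1 - a) * beta)
    (hscaling : 1 / tau + gamma / d%:R =
      a * (1 / p + (alpha - s) / d%:R) + (1 - a) * (1 / q + beta / d%:R))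
    (hineq :
      (0 < 1 / tau + gamma / d%:R /\
        exists C : R, 0 < C /\
          forall u : 'rV[R]_d -> R,
            radial u ->
            locally_integrable_rV (~` [set 0]) u ->
            compactly_supported u ->
            interpolation_ineq s p q tau a alpha beta gamma Lambda C u)
      \/
      (1 / tau + gamma / d%:R < 0 /\
        exists C : R, 0 < C /\
          forall u : 'rV[R]_d -> R,
            radial u ->
            locally_integrable_rV (~` [set 0]) u ->
            (\forall x \near (0 : 'rV[R]_d), u x = 0) ->
            interpolation_ineq s p q tau a alpha beta gamma Lambda C u)) :
  - (d%:R - 1) * s <= alpha - sigma.
Proof.
have d0 : (0 < d)%N by exact: leq_trans hd.
have p0 : 0 < p by rewrite (lt_trans _ hp).
have q0 : 0 < q by rewrite (lt_le_trans _ hq).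
have tau0 : 0 < tau by rewrite (lt_le_trans _ htau).
have [C C0 tentE] : exists2 C : R, 0 < C & forall e, 0 < e <= 1 / 2 ->
    interpolation_ineq s p q tau a alpha beta gamma Lambda C
      (tent e : 'rV[R]_d -> R).
  (* The tent is admissible under either assertion, having compact support and vanishing near the
     origin. *)
  case: hineq => -[_ [C [C0 CE]]]; exists C => // e e01;
    have /andP[e0 _] := e01; apply: CE.
  - exact: radial_tent.
  - exact: locally_integrable_tent.
  - exact: compactly_supported_tent.
  - exact: radial_tent.
  - exact: locally_integrable_tent.
  - exact: tent_near0.
have [C1 C10 sobE] := @sobolev_seminorm_tent_le R d s p alpha Lambda d0 hs0
  hs1 hp hLambda.
have [C2 C20 lqE] := @weighted_norm_tent_le R d d0 beta q q0.
have [c c0 ltauE] := @weighted_norm_tent_ge R d d0 gamma tau tau0.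
have a1 : 0 <= 1 - a by rewrite subr_ge0.
pose C3 := C * (C1 `^ a * C2 `^ (1 - a)).
have C30 : 0 < C3 by rewrite !mulr_gt0// powR_gt0.
(* The tent estimates bound [c * e^(1/tau)] by [C3] times the power of [e] coming from the
   right-hand side; the exponent here is that of the quotient. *)
have th0 : (p^-1 - s) * a + q^-1 * (1 - a) - tau^-1 <= 0.
  apply: (@powR_le_exponent_le0 _ c C3) => // e e01; have /andP[e0 _] := e01.
  have et : 0 < e `^ tau^-1 by exact: powR_gt0.
  rewrite (@powRB _ e); last by rewrite (gt_eqF e0) implybT.
  rewrite mulrA ler_pdivlMr//.
  rewrite -lee_fin; apply: le_trans (ltauE e e01) _.
  apply: le_trans (tentE e e01) _.
  apply: (@le_trans _ _ (C%:E * ((C1 * e `^ (p^-1 - s))%:E `^ a *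
      (C2 * e `^ q^-1)%:E `^ (1 - a)))%E).
    apply: lee_wpmul2l; first by rewrite lee_fin ltW.
    apply: lee_pmul; rewrite ?poweR_ge0//.
      apply: gt0_ler_poweR; rewrite ?(ltW ha0) ?in_itv/= ?leey ?andbT//.
      - exact: poweR_ge0.
      - by rewrite lee_fin mulr_ge0 ?powR_ge0// ltW.
      - exact: sobE.
    apply: gt0_ler_poweR; rewrite ?in_itv/= ?leey ?andbT//.
    - exact: Lnorm_ge0.
    - by rewrite lee_fin mulr_ge0 ?powR_ge0// ltW.
    - exact: lqE.
  rewrite !poweR_EFin -!EFinM lee_fin.
  rewrite powRM ?powR_ge0 ?(ltW C10)// powRM ?powR_ge0 ?(ltW C20)// -!powRrM.
  rewrite (@powRD _ e); last by rewrite (gt_eqF e0) implybT.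
  by rewrite /C3 le_eqVlt; apply/orP; left; apply/eqP; ring.
have dR : 0 < d%:R :> R by rewrite ltr0n.
(* Inserting the definition of [sigma] into the scaling relation cancels [beta] and eliminates
   [gamma]. *)
have tauE : tau^-1 = p^-1 * a + q^-1 * (1 - a) + a * (alpha - s - sigma) / d%:R.
  have -> : tau^-1 = (1 / tau + gamma / d%:R) - gamma / d%:R by field;
    rewrite gt_eqF ?gt_eqF.
  rewrite hscaling hsigma; field; rewrite !gt_eqF//.
move: th0; rewrite tauE.
(* The exponent is [- a / d] times the quantity to be shown nonnegative, and [a / d > 0]. *)
have -> : (p^-1 - s) * a + q^-1 * (1 - a) -
    (p^-1 * a + q^-1 * (1 - a) + a * (alpha - s - sigma) / d%:R) =
    - (a / d%:R * ((d%:R - 1) * s + (alpha - sigma))).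
  by field; rewrite !gt_eqF.
rewrite oppr_le0 pmulr_rge0 ?divr_gt0//; lra.
Qed.
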